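(* Let $\mathcal{X}$ be the set of mm-isomorphism classes of mm-spaces. No element $X \in \mathcal{X}$ has a compact neighborhood in $\mathcal{X}$ with respect to the box topology, and no element $X \in \mathcal{X}$ has a compact neighborhood in $\mathcal{X}$ with respect to the concentration topology. In particular, $\mathcal{X}$ is not locally compact in either topology.
   Context: An mm-space is a triple $(X,d_X,\mu_X)$ where $(X,d_X)$ is a complete separable metric space and $\mu_X$ is a Borel probability measure on $X$. Two mm-spaces $X,Y$ are mm-isomorphic if there is an isometry $f\colon \operatorname{supp}\mu_X\to\operatorname{supp}\mu_Y$ with $f_*\mu_X=\mu_Y$; $\mathcal{X}$ is the set of mm-isomorphism classes. A parameter of $X$ is a Borel map $\varphi\colon I=[0,1)\to X$ with $\varphi_*\mathcal{L}^1=\mu_X$ ($\mathcal{L}^1$ Lebesgue measure). The box distance $\square(X,Y)$ is the infimum of $\varepsilon\ge 0$ such that there exist parameters $\varphi$ of $X$, $\psi$ of $Y$ and a Borel set $I_0\subset I$ with $\mathcal{L}^1(I_0)\ge 1-\varepsilon$ and $|d_X(\varphi(s),\varphi(t))-d_Y(\psi(s),\psi(t))|\le\varepsilon$ for all $s,t\in I_0$; it is a metric on $\mathcal{X}$ and induces the box topology. For measurable $f,g\colon I\to\mathbb{R}$, the Ky Fan metric $d_{\mathrm{KF}}(f,g)$ is the infimum of $\varepsilon\ge0$ with $\mathcal{L}^1(\{|f-g|>\varepsilon\})\le\varepsilon$. The observable distance is $d_{\mathrm{conc}}(X,Y)=\inf_{\varphi,\psi} d_{\mathrm{H}}(\{f\circ\varphi: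 f\colon X\to\mathbb{R}\text{ 1-Lipschitz}\},\{g\circ\psi: g\colon Y\to\mathbb{R}\text{ 1-Lipschitz}\})$, the infimum over parameters and $d_{\mathrm{H}}$ the Hausdorff distance with respect to $d_{\mathrm{KF}}$; it is a metric on $\mathcal{X}$ and induces the concentration topology. *)

(* Defs.v *)
From HB Require Import structures.
From mathcomp Require Import all_boot all_order all_algebra.
From mathcomp Require Import all_classical all_reals all_analysis.
Unset Printing Implicit Defensive.
Import Order.TTheory GRing.Theory Num.Theory.
Import numFieldNormedType.Exports.
Local Open Scope classical_set_scope.
Local Open Scope ring_scope.

Section MetricNotions.
Context {R : realType} {T : Type} (d : T -> T -> R).

Definition is_metric : Prop :=
  (forall x y, d x y = 0 <-> x = y) /\
  (forall x y, d x y = d y x) /\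
  (forall x y z, d x z <= d x y + d y z).

Definition d_cauchy (u : nat -> T) : Prop :=
  forall e : R, 0 < e -> exists N : nat, forall m n : nat,
    (N <= m)%N -> (N <= n)%N -> d (u m) (u n) < e.

Definition d_complete : Prop :=
  forall u : nat -> T, d_cauchy u ->
    exists x : T, forall e : R, 0 < e -> exists N : nat, forall n : nat,
      (N <= n)%N -> d (u n) x < e.

Definition d_separable : Prop :=
  exists D : set T, countable D /\
    forall (x : T) (e : R), 0 < e -> exists y : T, D y /\ d x y < e.

Definition d_open (U : set T) : Prop :=
  forall x, U x -> exists2 r : R, 0 < r & forall y, d x y < r -> U y.

Definition d_borel : set (set T) := <<s d_open >>.

Lemma d_openT : d_open setT.
Proof. by move=> x _; exists 1 => //. Qed.

Lemma d_openI : setI_closed d_open.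
Proof.
move=> A B oA oB x [Ax Bx].
have [ra ra0 hA] := oA x Ax; have [rb rb0 hB] := oB x Bx.
exists (Order.min ra rb); first by rewrite lt_min ra0 rb0.
by move=> y; rewrite lt_min => /andP[/hA ? /hB ?].
Qed.

Lemma d_open_bigU (I : Type) (f : I -> set T) :
  (forall i, d_open (f i)) -> d_open (\bigcup_i f i).
Proof.
move=> hf x [i _ fxi]; have [r r0 h] := hf i x fxi.
by exists r => // y /h fiy; exists i.
Qed.

End MetricNotions.

Definition prob_on {R : realType} {T : Type} (B : set (set T))
    (mu : set T -> R) : Prop :=
  mu set0 = 0 /\ (forall A, B A -> 0 <= mu A) /\ mu setT = 1 /\
  (forall F : nat -> set T, (forall n, B (F n)) -> trivIset setT F ->
     (fun n : nat => \sum_(k < n) mu (F k)) @ \oo --> mu (\bigcup_n F n)).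

Record mmspace (R : realType) := MMSpace {
  mm_car :> Type;
  mm_d : mm_car -> mm_car -> R;
  mm_mu : set mm_car -> R;
  mm_metric : is_metric mm_d;
  mm_complete : d_complete mm_d;
  mm_separable : d_separable mm_d;
  mm_prob : prob_on (d_borel mm_d) mm_mu
}.
Arguments mm_d {R} m _ _.
Arguments mm_mu {R} m _.

Section Distances.
Context {R : realType}.

Definition Iunit : set R := `[0%R, 1%R[.
Local Notation L := (@lebesgue_measure R).

(* phi : I -> X (represented as a map R -> X whose values off I are irrelevant)
   is a parameter of X: Borel and phi_* L^1 = mu_X *)
Definition is_parameter (X : mmspace R) (phi : R -> X) : Prop :=
  (forall B, d_borel (mm_d X) B -> measurable (Iunit `&` phi @^-1` B)) /\
  (forall B, d_borel (mm_d X) B -> L (Iunit `&` phi @^-1` B) = (mm_mu X B)%:E).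

Definition box_dist (X Y : mmspace R) : R :=
  inf [set eps : R | 0 <= eps /\
    exists (phi : R -> X) (psi : R -> Y) (I0 : set R),
      [/\ is_parameter X phi, is_parameter Y psi,
          measurable I0 /\ I0 `<=` Iunit,
          ((1 - eps)%:E <= L I0)%E &
          forall s t, I0 s -> I0 t ->
            `| mm_d X (phi s) (phi t) - mm_d Y (psi s) (psi t) | <= eps]].

Definition ky_fan (f g : R -> R) : R :=
  inf [set eps : R | 0 <= eps /\
    (L (Iunit `&` [set s | (eps < `| f s - g s |)%R]) <= eps%:E)%E].

Definition hausdorff_KF (A B : set (R -> R)) : R :=
  inf [set r : R | 0 <= r /\
    (forall a, A a -> exists2 b, B b & ky_fan a b <= r) /\
    (forall b, B b -> exists2 a, A a & ky_fan a b <= r)].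

Definition lip1 (X : mmspace R) : set (X -> R) :=
  [set f | forall x y : X, `| f x - f y | <= mm_d X x y].

Definition conc_dist (X Y : mmspace R) : R :=
  inf [set r : R | exists (phi : R -> X) (psi : R -> Y),
    [/\ is_parameter X phi, is_parameter Y psi &
        r = hausdorff_KF [set f \o phi | f in lip1 X]
                         [set g \o psi | g in lip1 Y]]].

End Distances.

Definition box_space (R : realType) : Type := mmspace R.
Definition conc_space (R : realType) : Type := mmspace R.

HB.instance Definition _ (R : realType) := gen_eqMixin (box_space R).
HB.instance Definition _ (R : realType) := gen_choiceMixin (box_space R).
HB.instance Definition _ (R : realType) :=
  isOpenTopological.Build (box_space R)
    (@d_openT R _ box_dist) (@d_openI R _ box_dist) (@d_open_bigU R _ box_dist).

HB.instance Definition _ (R : realType) := gen_eqMixin (conc_space R).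
HB.instance Definition _ (R : realType) := gen_choiceMixin (conc_space R).
HB.instance Definition _ (R : realType) :=
  isOpenTopological.Build (conc_space R)
    (@d_openT R _ conc_dist) (@d_openI R _ conc_dist) (@d_open_bigU R _ conc_dist).

(* Main.v *)
Require Import Defs.
From HB Require Import structures.
From mathcomp Require Import all_boot all_order all_algebra.
From mathcomp Require Import all_classical all_reals all_analysis.
From mathcomp Require Import measurable_realfun lra ring.
Import Order.TTheory GRing.Theory Num.Theory.
Import numFieldNormedType.Exports.
Local Open Scope classical_set_scope.
Local Open Scope ring_scope.

(* For kappa > 0 and any mm-space X, the set of 1-Lipschitz functions
   X -> [0,1] is totally bounded in measure, so the number of functions in a
   kappa-separated family is bounded.  This bound is a quantity of X alone (it
   does not involve a choice of parameter) and it is locally bounded in the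
   concentration topology: if d_conc(X,Y) < r, a (kappa + 2r)-separated family
   on Y is approximated by a kappa-separated family on X.  Hence the bound is
   uniform on compact sets; since d_conc <= box, this holds in both topologies.
   On the other hand, given a parameter phi of X, the mm-space obtained as the
   law of t |-> (phi t, first n binary digits of t), with a jump of size e
   between different digit strings, is e-close to X in the box distance, and
   the n digits are n functions separated by e on a set of measure 1/2.  So no
   neighborhood of X is compact.

   Since the infimum over the empty set is 0, the distances are meaningful only
   because parameters exist.  A parameter is built from nested countable Borel
   partitions of X with diameters tending to 0 and nested partitions of [0,1)
   into intervals of the same masses. *)

(** * Metric and measure *)

Section Metric.
Context {R : realType} (X : mmspace R).
Local Notation d := (mm_d X).

Lemma mm_dxx (x : X) : d x x = 0.
Proof. by have [h _] := mm_metric R X; apply/h. Qed.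

Lemma mm_dC (x y : X) : d x y = d y x.
Proof. by have [_ [h _]] := mm_metric R X. Qed.

Lemma mm_d_triangle (y x z : X) : d x z <= d x y + d y z.
Proof. by have [_ [_ h]] := mm_metric R X. Qed.

Lemma mm_d_ge0 (x y : X) : 0 <= d x y.
Proof.
have := mm_d_triangle y x x; rewrite mm_dxx (mm_dC y x) => h.
by lra.
Qed.

End Metric.

Section Borel.
Context {R : realType} {T : Type} (d : T -> T -> R).
Local Notation borel := (d_borel d).

Lemma d_borel_sigma : sigma_algebra setT borel.
Proof. exact: smallest_sigma_algebra. Qed.

Lemma d_borel_open (U : set T) : d_open d U -> borel U.
Proof. by move=> oU; apply: sub_sigma_algebra. Qed.

Lemma d_borel0 : borel set0.
Proof. by have [] := d_borel_sigma. Qed.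

Lemma d_borelC (A : set T) : borel A -> borel (~` A).
Proof. by have [_ h _] := d_borel_sigma => /h; rewrite setTD. Qed.

Lemma d_borelT : borel setT.
Proof. by rewrite -setC0; exact: d_borelC d_borel0. Qed.

Lemma d_borel_bigcup (F : nat -> set T) :
  (forall n, borel (F n)) -> borel (\bigcup_n F n).
Proof. by have [_ _] := d_borel_sigma; exact. Qed.

Lemma d_borelU (A B : set T) : borel A -> borel B -> borel (A `|` B).
Proof.
move=> bA bB; rewrite -bigcup2E; apply: d_borel_bigcup => -[|[|n]] //=.
exact: d_borel0.
Qed.

Lemma d_borelI (A B : set T) : borel A -> borel B -> borel (A `&` B).
Proof.
move=> bA bB; rewrite -[A `&` B]setCK setCI.
by apply: d_borelC; apply: d_borelU; apply: d_borelC.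
Qed.

Lemma d_borel_bigcap_lt (F : nat -> set T) (n : nat) :
  (forall k, borel (F k)) -> borel [set x | forall k, (k < n)%N -> F k x].
Proof.
move=> bF; elim: n => [|n ih].
  rewrite (_ : [set x | _] = setT); first exact: d_borelT.
  by apply/seteqP; split.
rewrite (_ : [set x | _] = [set x | forall k, (k < n)%N -> F k x] `&` F n).
  exact: d_borelI.
apply/seteqP; split => x /=.
  by move=> h; split => [k kn|]; apply: h; rewrite ltnS ?leqnn// ltnW.
by move=> [h hn] k; rewrite ltnS leq_eqVlt => /orP[/eqP->|/h].
Qed.

(** Dynkin's pi-lambda theorem: open sets are stable under intersection, so complements and disjoint
    unions suffice. The induction is run on [borel] intersected with [P], which lets every case
    assume its sets Borel. *)
Lemma d_borel_ind (P : set (set T)) :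
  (forall U, d_open d U -> P U) ->
  (forall A, borel A -> P A -> P (~` A)) ->
  (forall F : nat -> set T, (forall n, borel (F n)) -> trivIset setT F ->
    (forall n, P (F n)) -> P (\bigcup_n F n)) ->
  forall B, borel B -> P B.
Proof.
move=> PO PC PU B bB; suff [] : (borel `&` P) B by [].
move: (bB); rewrite {1}/d_borel.
rewrite -(setI_closed_g_dynkin_g_sigma_algebra (@d_openI _ _ d)).
apply: smallest_sub; last first.
  by move=> U oU; split; [exact: d_borel_open|exact: PO].
split.
- by split; [exact: d_borelT|apply: PO; exact: d_openT].
- by move=> A [bA PA]; split; [exact: d_borelC|exact: PC].
- move=> F tF h; split; first by apply: d_borel_bigcup => n; have [] := h n.
  by apply: PU => // n; have [] := h n.
Qed.

End Borel.

Section Mass.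
Context {R : realType} (X : mmspace R).
Local Notation mu := (mm_mu X).
Local Notation borel := (d_borel (mm_d X)).

Lemma mm_mu0 : mu set0 = 0.
Proof. by have [] := mm_prob R X. Qed.

Lemma mm_mu_ge0 (A : set X) : borel A -> 0 <= mu A.
Proof. by have [_ [h _]] := mm_prob R X => /h. Qed.

Lemma mm_muT : mu setT = 1.
Proof. by have [_ [_ []]] := mm_prob R X. Qed.

Lemma mm_mu_bigcup (F : nat -> set X) :
  (forall n, borel (F n)) -> trivIset setT F ->
  (fun n : nat => \sum_(k < n) mu (F k)) @ \oo --> mu (\bigcup_n F n).
Proof. by have [_ [_ [_]]] := mm_prob R X; exact. Qed.

(** Countable additivity is applied to the sequence [A], its complement, then empty sets; the
    partial sums are constant from index 2 on. *)
Lemma mm_muC (A : set X) : borel A -> mu (~` A) = 1 - mu A.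
Proof.
move=> bA.
have bF n : borel (bigcup2 A (~` A) n).
  by case: n => [|[|n]] //=; [exact: d_borelC|exact: d_borel0].
have := mm_mu_bigcup (bigcup2 A (~` A)) bF.
rewrite -trivIset_bigcup2 setICr => /(_ erefl).
rewrite bigcup2E setUv mm_muT => h.
suff h2 : (fun n : nat => \sum_(k < n) mu (bigcup2 A (~` A) k)) @ \oo -->
    mu A + mu (~` A).
  by rewrite (cvg_unique _ h h2) // addrC addKr.
apply: cvg_near_cst; exists 2%N => // -[|[|n]] //= _.
rewrite !big_ord_recl big1 ?addr0// => i _.
by rewrite /= /bump /= mm_mu0.
Qed.

End Mass.

(** * Existence of parameters *)

(* Words list the most recent letter first, so [drop n w] is an ancestor of [w]. *)
Section WordTree.
Context {T : Type} (F : seq nat -> set T).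
Context (F_sub : forall k w, F (k :: w) `<=` F w).
Context (F_cover : forall w, F w `<=` \bigcup_k F (k :: w)).
Context (F_inj : forall w k l t, F (k :: w) t -> F (l :: w) t -> k = l).

Lemma tree_drop n w : F w `<=` F (drop n w).
Proof.
elim: w n => [|k w ih] [|n] //= t /F_sub /ih; exact.
Qed.

Lemma tree_size_inj w w' t : size w = size w' -> F w t -> F w' t -> w = w'.
Proof.
elim: w w' => [|k w ih] [|k' w'] //= [sw] Fw Fw'.
have e := ih _ sw (F_sub _ _ _ Fw) (F_sub _ _ _ Fw'); subst w'.
by rewrite (F_inj _ _ _ _ Fw Fw').
Qed.

(** Two cells that meet are nested: truncating the longer word to the length of the shorter one
    reduces to [tree_size_inj]. *)
Lemma tree_ancestor w w' t : (size w <= size w')%N -> F w t -> F w' t ->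
  w = drop (size w' - size w) w'.
Proof.
move=> le Fw Fw'; apply: (@tree_size_inj _ _ t) => //; last exact: tree_drop Fw'.
by rewrite size_drop subKn.
Qed.

Lemma tree_word n t : F [::] t -> exists2 w, size w = n & F w t.
Proof.
move=> F0; elim: n => [|n [w sw Fw]]; first by exists [::].
by have [k _ Fk] := F_cover _ _ Fw; exists (k :: w) => //=; rewrite sw.
Qed.

(** The words of [S] without a proper ancestor in [S]. They turn an arbitrary union of cells into a
    disjoint one, and they depend on [S] alone, not on the tree of sets. *)
Definition first_words (S : set (seq nat)) : set (seq nat) :=
  [set w | S w /\ forall n, (0 < n <= size w)%N -> ~ S (drop n w)].

(** Indexing by the code [pickle w] gives a sequence of sets, as countable additivity requires;
    indices that code no first word give the empty set. *)
Definition first_cell (S : set (seq nat)) (k : nat) : set T :=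
  [set t | exists2 w, pickle w = k & first_words S w /\ F w t].

Lemma first_cellE S w : first_words S w -> first_cell S (pickle w) = F w.
Proof.
move=> fw; apply/seteqP; split => t; last by exists w.
by move=> [w' /(pcan_inj pickleK) -> []].
Qed.

Lemma first_cell0 S k : ~ (exists2 w, pickle w = k & first_words S w) ->
  first_cell S k = set0.
Proof.
move=> h; apply/seteqP; split => t // [w wk [fw _]].
by apply: h; exists w.
Qed.

Lemma first_cell_trivIset S : trivIset setT (first_cell S).
Proof.
move=> k l _ _ [t [[w <- [fw Fw]] [w' <- [fw' Fw']]]]; congr pickle.
wlog le : w w' fw Fw fw' Fw' / (size w <= size w')%N => [wl|].
  by case/orP: (leq_total (size w) (size w')) => le; [|apply/esym]; apply: wl.
have e := tree_ancestor _ _ _ le Fw Fw'.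
have [e0|n0] := posnP (size w' - size w); first by rewrite e0 drop0 in e.
exfalso; have [_ /(_ (size w' - size w)%N)] := fw'; apply.
  by rewrite n0 leq_subr.
by rewrite -e; have [] := fw.
Qed.

Lemma first_cell_bigcup S : \bigcup_k first_cell S k = \bigcup_(w in S) F w.
Proof.
apply/seteqP; split => t.
  by move=> [_ _ [w _ [[Sw _] Fw]]]; exists w.
move=> [w Sw Fw].
have ex : exists n, `[< exists w, [/\ size w = n, S w & F w t] >].
  by exists (size w); apply/asboolP; exists w.
(* A shortest word of [S] whose cell contains [t] is a first word. *)
case: (ex_minnP ex) => n /asboolP[w' [sw' Sw' Fw']] nmin.
exists (pickle w') => //; exists w' => //; split => //; split => // m /andP[m0 mw] Sm.
have := nmin (size (drop m w')) => /(_ _)/wrap[].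
  by apply/asboolP; exists (drop m w'); split => //; exact: tree_drop Fw'.
by rewrite size_drop sw' leqNgt -sw' ltn_subrL m0 (leq_trans m0 mw).
Qed.

End WordTree.

Lemma small_invn {R : realType} (e : R) : 0 < e ->
  exists N : nat, forall n, (N <= n)%N -> n.+1%:R^-1 < e.
Proof.
move=> e0; exists (Num.truncn e^-1) => n Nn.
rewrite invf_plt ?posrE ?ltr0n//.
apply: (lt_le_trans (Num.Theory.truncnS_gt _)).
by rewrite ler_nat ltnS.
Qed.

Lemma dense_sequence {R : realType} (X : mmspace R) :
  exists q : nat -> X, forall (x : X) (e : R), 0 < e -> exists k, mm_d X x (q k) < e.
Proof.
have [D [/countable_injP[f finj] dD]] := mm_separable R X.
(* A default value for the indices that code no point of [D]; it exists because the total mass is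
   1. *)
have [x0 _] : [set: X] !=set0.
  apply/set0P/eqP => e.
  by have := @mm_muT _ X; rewrite e mm_mu0 => /esym/eqP; rewrite oner_eq0.
have /choice[q hq] : forall k, exists y, (exists x, D x /\ f x = k) -> D y /\ f y = k.
  move=> k; have [[x hx]|nx] := pselect (exists x, D x /\ f x = k).
    by exists x.
  by exists x0 => /nx.
exists q => x e e0; have [y [Dy dy]] := dD x e e0.
exists (f y); have [Dq fq] := hq (f y) (ex_intro _ y (conj Dy erefl)).
by rewrite (finj (q (f y)) y) ?inE.
Qed.

(** At level [n], take the balls of radius [n.+1%:R^-1 / 2] around a dense sequence and remove from
    each ball the earlier ones. *)
Lemma small_borel_partitions {R : realType} (X : mmspace R) :
  exists C : nat -> nat -> set X,
  [/\ forall n k, d_borel (mm_d X) (C n k),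
      forall n x, exists k, C n k x,
      forall n k l x, C n k x -> C n l x -> k = l &
      forall n k x y, C n k x -> C n k y -> mm_d X x y <= n.+1%:R^-1].
Proof.
have [q hq] := dense_sequence X.
pose B n k : set X := [set x | mm_d X x (q k) < n.+1%:R^-1 / 2].
have r0 n : 0 < n.+1%:R^-1 / 2 :> R by rewrite divr_gt0// invr_gt0 ltr0n.
have oB n k : d_borel (mm_d X) (B n k).
  apply: d_borel_open => x /= hx.
  exists (n.+1%:R^-1 / 2 - mm_d X x (q k)); first by rewrite subr_gt0.
  move=> y; rewrite /B /=; move: (_ / 2) => r hy.
  by have := mm_d_triangle _ x y (q k); rewrite (mm_dC _ y x); lra.
exists (fun n k => B n k `&` [set x | forall j, (j < k)%N -> (~` B n j) x]); split.
- move=> n k; apply: d_borelI => //.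
  by apply: d_borel_bigcap_lt => j; exact: d_borelC.
- move=> n x; have ex : exists k, mm_d X x (q k) < n.+1%:R^-1 / 2 by apply: hq.
  case: (ex_minnP ex) => k hk kmin; exists k; split => // j jk /= Bj.
  by have := kmin _ Bj; rewrite leqNgt jk.
- move=> n k l x [Bk nk] [Bl nl].
  by case: (ltngtP k l) => // lt; [have := nl _ lt|have := nk _ lt].
- move=> n k x y [Bx _] [By _]; have := mm_d_triangle _ (q k) x y.
  rewrite (mm_dC _ (q k) y); move: Bx By; rewrite /B /=.
  by move: (_^-1) => r; lra.
Qed.

Lemma lebesgue_Iunit {R : realType} : lebesgue_measure (@Iunit R) = 1%:E.
Proof. by rewrite lebesgue_measure_itv /= lte_fin ltr01 oppr0 adde0. Qed.

Lemma measurable_Iunit {R : realType} : measurable (@Iunit R).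
Proof. exact: measurable_itv. Qed.

Section ParameterExistence.
Context {R : realType} (X : mmspace R).
Local Notation d := (mm_d X).
Local Notation mu := (mm_mu X).
Local Notation borel := (d_borel (mm_d X)).
Local Notation L := (@lebesgue_measure R).
Context (C : nat -> nat -> set X).
Context (C_borel : forall n k, borel (C n k)).
Context (C_cover : forall n x, exists k, C n k x).
Context (C_inj : forall n k l x, C n k x -> C n l x -> k = l).
Context (C_diam : forall n k x y, C n k x -> C n k y -> d x y <= n.+1%:R^-1).

Fixpoint cylinder (w : seq nat) : set X :=
  if w is k :: w' then cylinder w' `&` C (size w') k else setT.

Fixpoint left_end (w : seq nat) : R :=
  if w is k :: w' then left_end w' + \sum_(i < k) mu (cylinder (nat_of_ord i :: w'))
  else 0.

(* The interval of [w] has length [mu (cylinder w)]; the intervals of the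
   children [k :: w] are laid out from left to right inside the one of [w]. *)
Definition itv_of (w : seq nat) : set R :=
  `[left_end w, left_end w + mu (cylinder w)[%classic.

Lemma cylinder_borel w : borel (cylinder w).
Proof.
by elim: w => [|k w ih] /=; [exact: d_borelT|exact: d_borelI].
Qed.

Lemma cylinder_sub k w : cylinder (k :: w) `<=` cylinder w.
Proof. by move=> x []. Qed.

Lemma cylinder_cover w : cylinder w `<=` \bigcup_k cylinder (k :: w).
Proof. by move=> x Ax; have [k] := C_cover (size w) x; exists k. Qed.

Lemma cylinder_inj w k l x : cylinder (k :: w) x -> cylinder (l :: w) x -> k = l.
Proof. by move=> [_ h] [_]; exact: C_inj h. Qed.

Lemma cylinder_diam w x y : (0 < size w)%N -> cylinder w x -> cylinder w y ->
  d x y <= (size w)%:R^-1.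
Proof. by case: w => //= k w _ [_ hx] [_]; exact: C_diam hx. Qed.

Local Notation psum w n := (\sum_(i < n) mu (cylinder (nat_of_ord i :: w))).

Lemma psum_cvg w : (fun n => psum w n) @ \oo --> mu (cylinder w).
Proof.
have -> : cylinder w = \bigcup_k cylinder (k :: w).
  by apply/seteqP; split => [|x [k _ /cylinder_sub]] //; exact: cylinder_cover.
apply: mm_mu_bigcup => [n|]; first exact: cylinder_borel.
by move=> k l _ _ [x [/cylinder_inj h /h]].
Qed.

Lemma psum_nd w : nondecreasing_seq (fun n => psum w n).
Proof.
apply/nondecreasing_seqP => n.
by rewrite big_ord_recr/= lerDl mm_mu_ge0//; exact: (cylinder_borel (n :: w)).
Qed.

Lemma psum_le w n : psum w n <= mu (cylinder w).
Proof.
rewrite -(cvg_lim _ (psum_cvg w)) //.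
apply: (nondecreasing_cvgn_le (psum_nd w)).
by apply/cvg_ex; exists (mu (cylinder w)); exact: psum_cvg.
Qed.

Lemma itv_ofE w t :
  itv_of w t <-> left_end w <= t < left_end w + mu (cylinder w).
Proof. by rewrite /itv_of /= in_itv. Qed.

Lemma itv_of_sub k w : itv_of (k :: w) `<=` itv_of w.
Proof.
move=> t /itv_ofE /= /andP[h1 h2]; apply/itv_ofE.
have := psum_le w k.+1; rewrite big_ord_recr /= => h3.
have h4 : 0 <= psum w k.
  by apply: sumr_ge0 => i _; apply: mm_mu_ge0; exact: (cylinder_borel (_ :: w)).
by apply/andP; split; lra.
Qed.

Lemma itv_of_cover w : itv_of w `<=` \bigcup_k itv_of (k :: w).
Proof.
move=> t /itv_ofE /andP[h1 h2].
have ex : exists n, t < left_end w + psum w n.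
  have h : t - left_end w < mu (cylinder w) by lra.
  have [n _ /(_ n (leqnn n)) /= hn] := cvgr_gt _ (psum_cvg w) _ h.
  by exists n; lra.
(* The least partial sum that passes [t] singles out the child whose interval contains [t]; the sum
   with no term cannot pass it. *)
case: (ex_minnP ex) => -[|n] hn nmin; first by rewrite big_ord0 in hn; lra.
exists n => //; apply/itv_ofE => /=; rewrite big_ord_recr/= addrA in hn.
rewrite hn andbT leNgt; apply/negP => /nmin.
by rewrite ltnn.
Qed.

Lemma itv_of_inj w k l t : itv_of (k :: w) t -> itv_of (l :: w) t -> k = l.
Proof.
wlog lt : k l / (k < l)%N => [wl hk hl|/itv_ofE /= /andP[_ h1] /itv_ofE /= /andP[h2 _]].
  by case: (ltngtP k l) => // lt; [|apply/esym]; apply: wl.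
exfalso; have := psum_nd w _ _ lt; rewrite big_ord_recr/= => h3.
by lra.
Qed.

Lemma lebesgue_itv_of w : L (itv_of w) = (mu (cylinder w))%:E.
Proof.
have m0 : 0 <= mu (cylinder w) by apply: mm_mu_ge0; exact: cylinder_borel.
rewrite /itv_of lebesgue_measure_itv /= lte_fin ltrDl.
case: ltP => [_|m1]; first by rewrite -EFinD addrC addKr.
by congr EFin; apply/eqP; rewrite eq_le m1 m0.
Qed.

Lemma itv_of_nil : itv_of [::] = Iunit.
Proof. by rewrite /itv_of /= mm_muT add0r. Qed.

Lemma itv_of_cylinder w t : itv_of w t -> cylinder w !=set0.
Proof.
move=> /itv_ofE h; apply/set0P/eqP => e; move: h.
by rewrite e mm_mu0 addr0 => /andP[/le_lt_trans h /h]; rewrite ltxx.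
Qed.

(** Both unions are decomposed along the same first words of [S], and corresponding cells have equal
    mass, so the two series agree term by term. *)
Lemma measure_words (S : set (seq nat)) :
  [/\ borel (\bigcup_(w in S) cylinder w),
      measurable (\bigcup_(w in S) itv_of w) &
      L (\bigcup_(w in S) itv_of w) = (mu (\bigcup_(w in S) cylinder w))%:E].
Proof.
rewrite -(first_cell_bigcup _ cylinder_sub) -(first_cell_bigcup _ itv_of_sub).
pose CS := first_cell cylinder S; pose IS := first_cell itv_of S.
have cell k : [/\ borel (CS k), measurable (IS k) & L (IS k) = (mu (CS k))%:E].
  rewrite /CS /IS; have [[w <- fw]|nw] := pselect (exists2 w, pickle w = k & first_words S w).
    rewrite !first_cellE//; split; [exact: cylinder_borel| |exact: lebesgue_itv_of].
    exact: measurable_itv.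
  by rewrite !first_cell0// mm_mu0 measure0; split => //; exact: d_borel0.
have bC : forall k, borel (CS k) by move=> k; have [] := cell k.
have mI : forall k, measurable (IS k) by move=> k; have [] := cell k.
have mU : measurable (\bigcup_k IS k) by apply: bigcupT_measurable.
split => //; first exact: d_borel_bigcup.
have tC : trivIset setT CS.
  by apply: first_cell_trivIset; [exact: cylinder_sub|exact: cylinder_inj].
have tI : trivIset setT IS.
  by apply: first_cell_trivIset; [exact: itv_of_sub|exact: itv_of_inj].
have cC := mm_mu_bigcup _ CS bC tC.
have cI := @measure_semi_sigma_additive _ _ _ L IS mI tI mU.
apply: (cvg_unique _ cI) => //.
have -> : (fun n : nat => (\sum_(0 <= i < n) L (IS i))%E) =
          EFin \o (fun n : nat => \sum_(k < n) mu (CS k)).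
  apply/funext => n /=; rewrite big_mkord -sumEFin.
  by apply: eq_bigr => i _; have [] := cell i.
by apply: cvg_EFin cC; exact: nearW.
Qed.

(** The words whose intervals contain [t] have nested nonempty cylinders with diameters tending to
    0; [x] is the limit of points chosen in them. It may lie outside the cylinders, hence only a
    distance bound is claimed. *)
Lemma limit_point_ex (t : R) : exists x : X, Iunit t ->
  forall w, (0 < size w)%N -> itv_of w t ->
    forall y, cylinder w y -> d y x <= (size w)%:R^-1.
Proof.
have [It|nIt] := pselect (Iunit t); last first.
  have [q _] := dense_sequence X.
  by exists (q 0%N) => /nIt.
have It0 : itv_of [::] t by rewrite itv_of_nil.
have /choice[y hy] : forall n, exists y, exists2 w, size w = n.+1 & itv_of w t /\ cylinder w y.
  move=> n; have [w sw Jw] := tree_word _ itv_of_cover n.+1 t It0.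
  by have [y Ay] := itv_of_cylinder _ _ Jw; exists y, w.
have near n w : size w = n.+1 -> itv_of w t -> forall m, (n <= m)%N -> cylinder w (y m).
  move=> sw Jw m nm; have [v sv [Jv Av]] := hy m.
  rewrite (tree_ancestor _ itv_of_sub itv_of_inj w v t) ?sw ?sv//.
  exact: tree_drop cylinder_sub _ _ _ Av.
have cy : d_cauchy d y.
  move=> e e0; have [N hN] := small_invn _ e0.
  exists N => m n Nm Nn; have [w sw [Jw _]] := hy N.
  apply: le_lt_trans (hN N (leqnn N)); rewrite -sw.
  by apply: cylinder_diam; rewrite ?sw//; exact: near _ _ sw Jw _ _.
have [x hx] := mm_complete R X y cy.
exists x => _ w sw0 Jw z Az; apply/ler_addgt0Pr => e e0.
have [N hN] := hx e e0.
have sw : size w = (size w).-1.+1 by rewrite prednK.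
(* Late enough for [y m] to be within [e] of the limit, and deep enough for [y m] to lie in
   [cylinder w]. *)
pose m := maxn N (size w).-1.
have Am : cylinder w (y m) by apply: (near _ _ sw Jw); exact: leq_maxr.
apply: le_trans (mm_d_triangle _ (y m) _ _) _; apply: lerD.
  exact: cylinder_diam.
by apply: ltW; apply: hN; exact: leq_maxl.
Qed.

Lemma parameter_ex_of_partitions : exists phi : R -> X, is_parameter X phi.
Proof.
have /choice[phi hphi] := limit_point_ex.
exists phi.
have opens U : d_open d U -> measurable (Iunit `&` phi @^-1` U) /\
    L (Iunit `&` phi @^-1` U) = (mu U)%:E.
  move=> oU.
  (* Words whose cylinder stays in [U] even after enlargement by its diameter bound. The margin
     absorbs the distance from [phi t] to the cylinder, so both [U] and its preimage are unions over
     this one [S]. *)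
  pose S : set (seq nat) := [set w | (0 < size w)%N /\
    forall x, cylinder w x -> forall y, d x y <= (size w)%:R^-1 -> U y].
  have [_ h1 h2] := measure_words S.
  have size_ex r : 0 < r -> exists2 n, (0 < n)%N & n%:R^-1 < r / 2 :> R.
    move=> r0; have [|N /(_ N (leqnn N))] := @small_invn _ (r / 2); first by lra.
    by exists N.+1.
  have eI : Iunit `&` phi @^-1` U = \bigcup_(w in S) itv_of w.
    apply/seteqP; split => t.
      move=> [It Ut]; have [r r0 hr] := oU _ Ut.
      have [n n0 nr] := size_ex _ r0.
      have [|w sw Jw] := tree_word _ itv_of_cover n t; first by rewrite itv_of_nil.
      exists w => //; split => [|x Ax y]; rewrite sw// => dxy.
      apply: hr; apply: le_lt_trans (mm_d_triangle _ x _ _) _.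
      have := hphi t It w; rewrite sw => /(_ n0 Jw x Ax).
      by rewrite (mm_dC _ x (phi t)); lra.
    move=> [w [w0 Sw] Jw].
    have It : Iunit t.
      by rewrite -itv_of_nil -(drop_size w); exact: (tree_drop _ itv_of_sub) Jw.
    split => //; have [x Ax] := itv_of_cylinder _ _ Jw.
    by apply: (Sw x Ax); exact: (hphi t It w).
  have eU : U = \bigcup_(w in S) cylinder w.
    apply/seteqP; split => x.
      move=> Ux; have [r r0 hr] := oU _ Ux.
      have [n n0 nr] := size_ex _ r0.
      have [//|w sw Aw] := tree_word _ cylinder_cover n x.
      exists w => //; split => [|y Ay z]; rewrite sw// => dyz.
      apply: hr; apply: le_lt_trans (mm_d_triangle _ y _ _) _.
      have := cylinder_diam w x y; rewrite sw => /(_ n0 Aw Ay).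
      by lra.
    move=> [w [w0 Sw] Aw]; apply: (Sw x Aw).
    by rewrite mm_dxx invr_ge0.
  by rewrite eI eU.
suff h B : borel B -> measurable (Iunit `&` phi @^-1` B) /\
    L (Iunit `&` phi @^-1` B) = (mu B)%:E.
  by split => B /h[].
move: B; apply: d_borel_ind => //.
- move=> A bA [mA LA].
  have -> : Iunit `&` phi @^-1` (~` A) = Iunit `\` (Iunit `&` phi @^-1` A).
    by apply/seteqP; split => t [It h]; split => //; [move=> [_ /h]|move=> At; apply: h].
  split; first exact: measurableD (measurable_itv _) mA.
  have Ioo : (L Iunit < +oo)%E by rewrite lebesgue_Iunit ltry.
  have e := @measureD _ _ _ L _ _ measurable_Iunit mA Ioo.
  rewrite setIA setIid in e.
  by rewrite mm_muC// EFinB -lebesgue_Iunit -LA; exact: e.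
- move=> F bF tF hF; rewrite preimage_bigcup setI_bigcupr.
  have mF n : measurable (Iunit `&` phi @^-1` F n) by have [] := hF n.
  have mU : measurable (\bigcup_n (Iunit `&` phi @^-1` F n)).
    exact: bigcupT_measurable.
  split => //.
  have tG : trivIset setT (fun n => Iunit `&` phi @^-1` F n).
    move=> k l _ _ [t [[_ Fk] [_ Fl]]]; apply: tF => //.
    by exists (phi t).
  have cI := @measure_semi_sigma_additive _ _ _ L _ mF tG mU.
  apply: (cvg_unique _ cI) => //.
  rewrite (_ : (fun n : nat => _) = EFin \o (fun n : nat => \sum_(k < n) mu (F k))).
    by apply: cvg_EFin (mm_mu_bigcup _ F bF tF); exact: nearW.
  apply/funext => n /=; rewrite big_mkord -sumEFin.
  by apply: eq_bigr => i _; have [] := hF i.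
Qed.

End ParameterExistence.

Lemma parameter_ex {R : realType} (X : mmspace R) :
  exists phi : R -> X, is_parameter X phi.
Proof.
have [C [? ? ? ?]] := small_borel_partitions X.
exact: (parameter_ex_of_partitions X C).
Qed.

(** * Separated families of Lipschitz functions *)

Section Deviation.
Context {R : realType}.
Local Notation L := (@lebesgue_measure R).

Lemma inf_ge0 (S : set R) : (forall x, S x -> 0 <= x) -> 0 <= inf S.
Proof.
move=> h; have [->|/set0P S0] := eqVneq S set0; first by rewrite inf0.
exact: lb_le_inf.
Qed.

Lemma inf_le_of (S : set R) (x : R) : (forall x, S x -> 0 <= x) -> S x -> inf S <= x.
Proof. by move=> h Sx; apply: ge_inf => //; exists 0. Qed.

Lemma le_lebesgue (A B : set R) : measurable A -> measurable B -> A `<=` B ->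
  (L A <= L B)%E.
Proof. by move=> mA mB; apply: (@le_measure _ _ _ L); rewrite inE. Qed.

Lemma lebesgue_IunitD (A : set R) : measurable A -> A `<=` Iunit ->
  L (Iunit `\` A) = (1 - L A)%E.
Proof.
move=> mA AI; have Ioo : (L Iunit < +oo)%E by rewrite lebesgue_Iunit ltry.
have e := @measureD _ _ _ L _ _ measurable_Iunit mA Ioo.
by rewrite (setIidr AI) in e; rewrite -lebesgue_Iunit; exact: e.
Qed.

Definition deviation (c : R) (u v : R -> R) : set R :=
  Iunit `&` [set s | c < `|u s - v s|].

Lemma measurable_deviation c u v : measurable_fun Iunit u ->
  measurable_fun Iunit v -> measurable (deviation c u v).
Proof.
move=> mu mv.
have m : measurable_fun Iunit (fun s => `|u s - v s|).
  by apply: measurableT_comp => //; exact: measurable_funB.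
have := m measurable_Iunit _ (measurable_itv `]c, +oo[).
congr (measurable (_ `&` _)); apply/seteqP; split => s /=;
  by rewrite in_itv /= andbT.
Qed.

Lemma deviationC c u v : deviation c u v = deviation c v u.
Proof. by apply/seteqP; split => s [Is]; rewrite /= distrC. Qed.

Lemma sub_deviation c c' u v : c <= c' -> deviation c' u v `<=` deviation c u v.
Proof. by move=> cc s [Is] /= h; split => //=; exact: le_lt_trans h. Qed.

Lemma lebesgue_deviation_le1 c u v : measurable_fun Iunit u ->
  measurable_fun Iunit v -> (L (deviation c u v) <= 1%:E)%E.
Proof.
move=> mu mv; rewrite -lebesgue_Iunit; apply: le_lebesgue.
- exact: measurable_deviation.
- exact: measurable_Iunit.
- by move=> s [].
Qed.

Lemma lebesgue_deviationD c c' u v w : measurable_fun Iunit u ->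
  measurable_fun Iunit v -> measurable_fun Iunit w ->
  (L (deviation (c + c') u w) <= L (deviation c u v) + L (deviation c' v w))%E.
Proof.
move=> mu mv mw.
apply: (@le_trans _ _ (L (deviation c u v `|` deviation c' v w))).
  apply: le_lebesgue; first exact: measurable_deviation.
    by apply: measurableU; exact: measurable_deviation.
  move=> s [Is] /= h; have [h1|h1] := ltP c `|u s - v s|; [left|right]; split => //=.
  have := ler_normD (u s - v s) (v s - w s); rewrite addrA subrK.
  by lra.
by apply: measureU2; exact: measurable_deviation.
Qed.

Lemma ky_fan_le (u v : R -> R) (eps : R) : 0 <= eps ->
  (L (deviation eps u v) <= eps%:E)%E -> ky_fan u v <= eps.
Proof. by move=> e0 h; apply: inf_le_of => // x []. Qed.

(** Some admissible [eps < r] exists, and raising the threshold from [eps] to [r] only shrinks the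
    deviation set. *)
Lemma ky_fan_dev (u v : R -> R) (r : R) : measurable_fun Iunit u ->
  measurable_fun Iunit v -> ky_fan u v < r -> (L (deviation r u v) <= r%:E)%E.
Proof.
move=> mu mv /inf_lt[|eps [e0 h] er].
  by exists 1; split => //; exact: lebesgue_deviation_le1.
apply: (@le_trans _ _ eps%:E); last by rewrite lee_fin ltW.
apply: le_trans h; apply: le_lebesgue; try exact: measurable_deviation.
exact/sub_deviation/ltW.
Qed.

Lemma ky_fan_le1 (u v : R -> R) : measurable_fun Iunit u ->
  measurable_fun Iunit v -> ky_fan u v <= 1.
Proof.
by move=> mu mv; apply: ky_fan_le => //; exact: lebesgue_deviation_le1.
Qed.

Lemma ky_fanC (u v : R -> R) : ky_fan u v = ky_fan v u.
Proof.
rewrite /ky_fan; congr inf; apply/seteqP; split => e /= [e0];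
  rewrite -!/(deviation _ _ _) deviationC //.
Qed.

End Deviation.

Section Lipschitz.
Context {R : realType} (X : mmspace R).
Local Notation L := (@lebesgue_measure R).
Local Notation mu := (mm_mu X).

Lemma lip1_cst (c : R) : lip1 X (fun=> c).
Proof. by move=> x y; rewrite subrr normr0 mm_d_ge0. Qed.

Lemma lip1_gt_open f (a : R) : lip1 X f -> d_open (mm_d X) [set x | a < f x].
Proof.
move=> lf x /= ax; exists (f x - a); first by rewrite subr_gt0.
by move=> y; have := lf x y; rewrite ler_norml => /andP[]; lra.
Qed.

Lemma lip1_dist_open f g (a : R) : lip1 X f -> lip1 X g ->
  d_open (mm_d X) [set x | a < `|f x - g x|].
Proof.
move=> lf lg x /= ax; exists ((`|f x - g x| - a) / 2).
  by rewrite divr_gt0// subr_gt0.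
move=> y xy; have := lf x y; have := lg x y.
have := ler_normD (f x - f y) (f y - g y).
have := ler_normD (f x - f y + (f y - g y)) (g y - g x).
rewrite (_ : f x - f y + (f y - g y) + (g y - g x) = f x - g x); last by ring.
rewrite (distrC (g y)); lra.
Qed.

Lemma lip1_measurable f phi : lip1 X f -> is_parameter X phi ->
  measurable_fun Iunit (f \o phi).
Proof.
move=> lf [mphi _] mI; apply: (measurability _ (RGenOInfty.measurableE R)) => //.
move=> _ [_ [a ->] <-].
have := mphi _ (d_borel_open _ _ (lip1_gt_open f a lf)).
congr (measurable (_ `&` _)); apply/seteqP; split => s /=;
  by rewrite in_itv /= andbT.
Qed.

Lemma mm_mu_deviation f g phi c : lip1 X f -> lip1 X g -> is_parameter X phi ->
  L (deviation c (f \o phi) (g \o phi)) = (mu [set x | c < `|f x - g x|])%:E.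
Proof. by move=> lf lg [_ h]; apply: h; apply: d_borel_open; exact: lip1_dist_open. Qed.

(** Monotonicity is pulled back to Lebesgue measure through a parameter. *)
Lemma le_mm_mu (A B : set X) : d_borel (mm_d X) A -> d_borel (mm_d X) B ->
  A `<=` B -> mu A <= mu B.
Proof.
move=> bA bB AB; have [phi [mphi Lphi]] := parameter_ex X.
rewrite -lee_fin -!Lphi//; apply: le_lebesgue; [exact: mphi|exact: mphi|].
by move=> s [Is /AB].
Qed.

End Lipschitz.

Section Clip.
Context {R : realType}.

(** Makes a 1-Lipschitz approximant of a [[0,1]]-valued function [[0,1]]-valued itself, without
    worsening the approximation. *)
Definition clip (a : R) : R := Num.min (Num.max a 0) 1.

Lemma clip_bounds a : 0 <= clip a <= 1.
Proof. by rewrite /clip /Num.max /Num.min; do !case: ifP; lra. Qed.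

Lemma clip_id a : 0 <= a <= 1 -> clip a = a.
Proof.
move=> /andP[a0 a1]; rewrite /clip (max_idPl _)//.
exact/min_idPl.
Qed.

Lemma clip_dist a b : `|clip a - clip b| <= `|a - b|.
Proof.
wlog ab : a b / a <= b => [wl|].
  case/orP: (le_total a b) => h; first exact: wl.
  by rewrite distrC (distrC a); exact: wl.
have cab : clip a <= clip b /\ clip b - clip a <= b - a.
  rewrite /clip /Num.max /Num.min.
  by case: (ltP a 0) => ?; case: (ltP b 0) => ?; do !case: ltP => ?; split; lra.
rewrite distrC (distrC a) !ger0_norm ?subr_ge0//; lra.
Qed.

End Clip.

Section Separation.
Context {R : realType}.
Local Notation L := (@lebesgue_measure R).

(* [mu {kappa < |f - g|} <= kappa] says that the Ky Fan distance of [f \o phi]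
   and [g \o phi] is at most [kappa], for any parameter [phi] of [X]. *)
Definition few_separated (X : mmspace R) (kappa : R) (m : nat) : Prop :=
  forall h : 'I_m -> X -> R,
    (forall i, lip1 X (h i) /\ forall x, 0 <= h i x <= 1) ->
    exists i j, i != j /\ mm_mu X [set x | kappa < `|h i x - h j x|] <= kappa.

Lemma few_separatedW (X : mmspace R) kappa m n : (m <= n)%N ->
  few_separated X kappa m -> few_separated X kappa n.
Proof.
move=> mn fs h hh.
have [i [j [ij hij]]] := fs (h \o widen_ord mn) (fun i => hh (widen_ord mn i)).
by exists (widen_ord mn i), (widen_ord mn j).
Qed.

Lemma hausdorff_lt (X Y : mmspace R) phi psi (r : R) :
  is_parameter X phi -> is_parameter Y psi ->
  hausdorff_KF [set f \o phi | f in lip1 X] [set g \o psi | g in lip1 Y] < r ->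
  forall g, lip1 Y g -> exists2 f, lip1 X f & ky_fan (f \o phi) (g \o psi) < r.
Proof.
move=> pphi ppsi hr g lg; case: (inf_lt _ hr) => [|r' [r'0 [_ h]] r'r].
  (* Radius 1 is always admissible, since the Ky Fan metric is at most 1 and both families contain
     the constant 0. *)
  exists 1; split => //; split.
    move=> _ [f lf <-]; exists ((fun=> 0) \o psi).
      by exists (fun=> 0) => //; exact: lip1_cst.
    by apply: ky_fan_le1; apply: lip1_measurable => //; exact: lip1_cst.
  move=> _ [f lf <-]; exists ((fun=> 0) \o phi).
    by exists (fun=> 0) => //; exact: lip1_cst.
  by apply: ky_fan_le1; apply: lip1_measurable => //; exact: lip1_cst.
have [|_ [f lf <-] hf] := h (g \o psi); first by exists g.
by exists f => //; exact: le_lt_trans r'r.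
Qed.

(* Separation is measured inside a single space, hence does not depend on the
   parameter: no gluing of parameters is needed to move it from [X] to [Y]. *)
Lemma few_separated_conc (X Y : mmspace R) (r kappa : R) m :
  conc_dist X Y < r -> few_separated X kappa m ->
  few_separated Y (kappa + 2 * r) m.
Proof.
move=> /inf_lt[|_ [phi [psi [pphi ppsi ->]]] hr].
  have [phi pphi] := parameter_ex X; have [psi ppsi] := parameter_ex Y.
  by eexists; exists phi, psi.
move=> fs h hh.
have /choice[a ha] : forall i, exists a, lip1 X a /\ ky_fan (a \o phi) (h i \o psi) < r.
  move=> i; have [lh _] := hh i.
  by have [a] := hausdorff_lt _ _ _ _ _ pphi ppsi hr _ lh; exists a.
pose c i := clip \o a i.
have lc i : lip1 X (c i).
  by move=> x y; have [la _] := ha i; exact: le_trans (clip_dist _ _) (la x y).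
have [|i [j [ij hij]]] := fs c.
  by move=> i; split => // x; exact: clip_bounds.
exists i, j; split => //.
have lh k : lip1 Y (h k) by have [] := hh k.
have mh k : measurable_fun Iunit (h k \o psi) by exact: lip1_measurable.
have mc k : measurable_fun Iunit (c k \o phi) by exact: lip1_measurable.
have dev k : (L (deviation r (c k \o phi) (h k \o psi)) <= r%:E)%E.
  have [la hk] := ha k.
  have ma : measurable_fun Iunit (a k \o phi) by exact: lip1_measurable.
  apply: le_trans (ky_fan_dev _ _ _ ma (mh k) hk).
  apply: le_lebesgue; try exact: measurable_deviation.
  move=> s [Is] /= hs; split => //=; apply: lt_le_trans hs _.
  have [_ /(_ (psi s)) b] := hh k.
  by rewrite /c /= -{1}(clip_id _ b); exact: clip_dist.
rewrite -lee_fin -(mm_mu_deviation _ _ _ _ _ (lh i) (lh j) ppsi).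
(* Triangle inequality along [h i], [c i], [c j], [h j]: thresholds and measures add up in the same
   way. *)
rewrite (_ : kappa + 2 * r = r + (kappa + r)); last by ring.
apply: le_trans (lebesgue_deviationD _ _ _ (c i \o phi) _ _ _ _) _ => //.
rewrite [leRHS]EFinD; apply: leeD; first by rewrite deviationC.
apply: le_trans (lebesgue_deviationD _ _ _ (c j \o phi) _ _ _ _) _ => //.
rewrite [leRHS]EFinD; apply: leeD => //.
by rewrite mm_mu_deviation// lee_fin.
Qed.

(** Finite unions of [delta]-balls around a dense sequence increase to [X]; continuity from below is
    used for Lebesgue measure, on their preimages under a parameter. *)
Lemma finite_net (X : mmspace R) (delta kappa : R) : 0 < delta -> 0 < kappa ->
  exists (p : nat) (q : nat -> X),
    let B := [set x | exists2 k, (k < p)%N & mm_d X x (q k) < delta] in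
    d_borel (mm_d X) B /\ 1 - kappa < mm_mu X B.
Proof.
move=> d0 k0; have [q hq] := dense_sequence X.
pose B p : set X := [set x | exists2 k, (k < p)%N & mm_d X x (q k) < delta].
have bB p : d_borel (mm_d X) (B p).
  apply: d_borel_open => x [k kp xk].
  exists (delta - mm_d X x (q k)); first by rewrite subr_gt0.
  move=> y xy; exists k => //; have := mm_d_triangle _ x y (q k).
  by rewrite (mm_dC _ y x); lra.
have [phi [mphi Lphi]] := parameter_ex X.
pose F p := Iunit `&` phi @^-1` B p.
have mF p : measurable (F p) by exact: mphi.
have UF : \bigcup_p F p = Iunit.
  apply/seteqP; split => [s [p _ []]//|s Is].
  by have [k hk] := hq (phi s) _ d0; exists k.+1 => //; split => //; exists k.
have ndF : {homo F : n m / (n <= m)%N >-> (n <= m)%O}.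
  move=> n m nm; apply/subsetPset => s [Is [k kn hk]]; split => //.
  by exists k => //; exact: leq_trans nm.
have := @nondecreasing_cvg_mu _ _ _ L F mF.
rewrite UF => /(_ measurable_Iunit ndF) cF.
have : (fun p => mm_mu X (B p)) @ \oo --> (1 : R).
  have -> : (fun p => mm_mu X (B p)) = fine \o (L \o F).
    by apply/funext => p /=; rewrite Lphi.
  by apply: fine_cvg; rewrite -lebesgue_Iunit.
move=> /cvgr_gt /(_ (1 - kappa)) [|p _ /(_ p (leqnn p)) hp]; first by lra.
by exists p, q; split; [exact: bB|exact: hp].
Qed.

(** Pigeonhole on the values at the net points, rounded to multiples of [1/N]. Two functions with
    equal roundings differ by at most [kappa / 4] at net points, hence by less than [kappa] on [B],
    and the complement of [B] has mass below [kappa]. *)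
Lemma few_separated_ex (X : mmspace R) (kappa : R) : 0 < kappa ->
  exists m, few_separated X kappa m.
Proof.
move=> k0; have d0 : 0 < kappa / 4 by lra.
have [p [q [bB hB]]] := finite_net X _ _ d0 k0.
set B := [set x | _] in bB hB.
have [N0 /(_ N0 (leqnn N0)) hN] := small_invn _ d0; set N := N0.+1 in hN.
have N0' : 0 < N%:R :> R by rewrite ltr0n.
(* There are [N.+1] roundings and not [N], because a function may take the value 1. *)
pose Q (f : X -> R) : {ffun 'I_p -> 'I_N.+1} :=
  [ffun k => inord (Num.truncn (f (q (nat_of_ord k)) * N%:R))].
exists #|{ffun 'I_p -> 'I_N.+1}|.+1 => h hh.
have [i [j [ij Qij]]] : exists i j, i != j /\ Q (h i) = Q (h j).
  apply: contrapT => nij.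
  have /leq_card : injective (Q \o h).
    move=> i j /= e; apply/eqP; apply: contrapT => /negP ne.
    by apply: nij; exists i, j.
  by rewrite card_ord ltnn.
exists i, j; split => //.
have close k : (k < p)%N -> `|h i (q k) - h j (q k)| <= kappa / 4.
  move=> kp; have := congr1 (fun g : {ffun _} => nat_of_ord (g (Ordinal kp))) Qij.
  rewrite !ffunE /=.
  have b l : 0 <= h l (q k) * N%:R <= N%:R.
    have [_ /(_ (q k)) /andP[b0 b1]] := hh l.
    by rewrite mulr_ge0 ?ler0n//= ler_piMl ?ler0n.
  have tr l : (Num.truncn (h l (q k) * N%:R) < N.+1)%N.
    have /andP[b0 b1] := b l.
    by rewrite truncn_lt_nat//; apply: le_lt_trans b1 _; rewrite ltr_nat.
  rewrite !inordK// => e.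
  have /andP[/truncn_itv/andP[i1 i2] _] := b i.
  have /andP[/truncn_itv/andP[j1 j2] _] := b j.
  rewrite e in i1 i2; rewrite -natr1 in i2; rewrite -natr1 in j2.
  apply: le_trans (ltW hN); rewrite -(ler_pM2r N0') mulVf ?gt_eqF//.
  rewrite -[X in _ * X](ger0_norm (ltW N0')) -normrM mulrBl ler_norml.
  by apply/andP; split; lra.
have sub : [set x | kappa < `|h i x - h j x|] `<=` ~` B.
  move=> x /= hx [k kp xk]; have [li _] := hh i; have [lj _] := hh j.
  have := close k kp; have := li x (q k); have := lj x (q k).
  have := ler_normD (h i x - h i (q k)) (h i (q k) - h j (q k)).
  have := ler_normD (h i x - h i (q k) + (h i (q k) - h j (q k))) (h j (q k) - h j x).
  rewrite (_ : _ + _ + (h j (q k) - h j x) = h i x - h j x); last by ring.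
  by rewrite (distrC (h j (q k))); lra.
apply: le_trans (le_mm_mu _ _ _ _ _ sub) _.
- have [li _] := hh i; have [lj _] := hh j.
  by apply: d_borel_open; exact: lip1_dist_open.
- exact: d_borelC.
- by rewrite mm_muC//; lra.
Qed.

End Separation.

(** * Box distance and observable distance *)

Section BoxConc.
Context {R : realType}.
Local Notation L := (@lebesgue_measure R).

(* The witness is the McShane extension of [f \o phi], read through [psi]. *)
Lemma lip1_transfer (X Y : mmspace R) phi psi (I0 : set R) (eps : R) f :
  is_parameter X phi -> is_parameter Y psi ->
  measurable I0 -> I0 `<=` Iunit -> ((1 - eps)%:E <= L I0)%E ->
  (forall s t, I0 s -> I0 t ->
    `|mm_d X (phi s) (phi t) - mm_d Y (psi s) (psi t)| <= eps) ->
  0 <= eps -> lip1 X f ->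
  exists2 g, lip1 Y g & ky_fan (f \o phi) (g \o psi) <= eps.
Proof.
move=> pphi ppsi mI0 I0I LI0 dI0 eps0 lf.
have mf : measurable_fun Iunit (f \o phi) by exact: lip1_measurable.
(* If [I0] is empty then [eps >= 1], and any function will do. *)
have [I00|/set0P[s0 Is0]] := eqVneq I0 set0.
  have lc := lip1_cst Y 0.
  exists (fun=> 0) => //; apply: le_trans (ky_fan_le1 _ _ mf (lip1_measurable _ _ _ lc ppsi)) _.
  by move: LI0; rewrite I00 measure0 lee_fin; lra.
pose S y := [set f (phi s) + mm_d Y (psi s) y | s in I0].
have S0 y : S y !=set0 by exists (f (phi s0) + mm_d Y (psi s0) y), s0.
(* The infimum defining [g] is finite: passing from distances in [X] to distances in [Y] costs at
   most [eps]. *)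
have lbS y : lbound (S y) (f (phi s0) - eps - mm_d Y (psi s0) y).
  move=> _ [s Is <-]; have := dI0 _ _ Is Is0; have := lf (phi s) (phi s0).
  have := mm_d_triangle _ y (psi s) (psi s0); rewrite (mm_dC _ y).
  by rewrite !ler_norml => ? /andP[? ?] /andP[? ?]; lra.
have hlbS y : has_lbound (S y) by exists (f (phi s0) - eps - mm_d Y (psi s0) y).
pose g y := inf (S y).
have g_le y y' : g y <= g y' + mm_d Y y y'.
  rewrite -lerBlDr; apply: lb_le_inf => // _ [s Is <-].
  have : g y <= f (phi s) + mm_d Y (psi s) y by apply: ge_inf => //; exists s.
  have := mm_d_triangle _ y' (psi s) y; rewrite (mm_dC _ y' y).
  by lra.
have lg : lip1 Y g.
  move=> y y'; rewrite ler_norml; have := g_le y y'; have := g_le y' y.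
  by rewrite (mm_dC _ y' y) => ? ?; apply/andP; split; lra.
exists g => //; apply: ky_fan_le => //.
have close t : I0 t -> `|(f \o phi) t - (g \o psi) t| <= eps.
  move=> It /=.
  have h1 : g (psi t) <= f (phi t).
    by apply: ge_inf => //; exists t => //; rewrite mm_dxx addr0.
  have h2 : f (phi t) - eps <= g (psi t).
    apply: lb_le_inf => // _ [s Is <-].
    have := dI0 _ _ Is It; have := lf (phi s) (phi t).
    by rewrite !ler_norml => /andP[? ?] /andP[? ?]; lra.
  by rewrite ger0_norm; lra.
apply: (@le_trans _ _ (L (Iunit `\` I0))).
  apply: le_lebesgue.
  - by apply: measurable_deviation => //; exact: lip1_measurable.
  - exact: measurableD measurable_Iunit mI0.
  - move=> s [Is hs]; split => // /close.
    by rewrite leNgt => /negP; apply.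
rewrite lebesgue_IunitD//.
have Lfin : L I0 \is a fin_num.
  rewrite ge0_fin_numE//; apply: (@le_lt_trans _ _ (L Iunit)).
    exact: le_lebesgue measurable_Iunit I0I.
  by rewrite lebesgue_Iunit ltry.
rewrite -(fineK Lfin) in LI0 *; rewrite -EFinB lee_fin.
by rewrite lee_fin in LI0; lra.
Qed.

(** The parameters that witness the box distance also serve for the observable distance;
    [lip1_transfer] is applied in both directions. *)
Lemma conc_dist_lt_box (X Y : mmspace R) (r : R) :
  box_dist X Y < r -> conc_dist X Y < r.
Proof.
move=> /inf_lt[|eps [eps0 [phi [psi [I0 [pphi ppsi [mI0 I0I] LI0 dI0]]]]] er].
  have [phi pphi] := parameter_ex X; have [psi ppsi] := parameter_ex Y.
  (* With [eps = 1] the empty [I0] is allowed, so the infimum is not over an empty set. *)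
  exists 1; split => //; exists phi, psi, set0; split => //; first by split.
  by rewrite subrr measure0.
apply: le_lt_trans er.
apply: (@le_trans _ _ (hausdorff_KF [set f \o phi | f in lip1 X] [set g \o psi | g in lip1 Y])).
  apply: inf_le_of; last by exists phi, psi.
  by move=> _ [? [? [_ _ ->]]]; apply: inf_ge0 => x [].
apply: inf_le_of => [x []//|]; split => //; split.
  move=> _ [f lf <-].
  have [g lg hg] := lip1_transfer _ _ _ _ _ _ _ pphi ppsi mI0 I0I LI0 dI0 eps0 lf.
  by exists (g \o psi) => //; exists g.
move=> _ [g lg <-].
have dI0' s t : I0 s -> I0 t ->
    `|mm_d Y (psi s) (psi t) - mm_d X (phi s) (phi t)| <= eps.
  by rewrite distrC; exact: dI0.
have [f lf hf] := lip1_transfer _ _ _ _ _ _ _ ppsi pphi mI0 I0I LI0 dI0' eps0 lg.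
by exists (f \o phi); [exists f|rewrite ky_fanC].
Qed.

End BoxConc.

(** * Spaces with many separated functions near a given space *)

Section Pushforward.
Context {R : realType} {T : Type} (d : T -> T -> R) (Phi : R -> T).
Local Notation L := (@lebesgue_measure R).
Context (d_metric : is_metric d) (d_compl : d_complete d) (d_sep : d_separable d).
Context (Phi_open : forall U, d_open d U -> measurable (Iunit `&` Phi @^-1` U)).

Lemma push_measurable (B : set T) : d_borel d B -> measurable (Iunit `&` Phi @^-1` B).
Proof.
move: B; apply: d_borel_ind => //.
  move=> A _ mA.
  have -> : Iunit `&` Phi @^-1` (~` A) = Iunit `\` (Iunit `&` Phi @^-1` A).
    by apply/seteqP; split => t [It h]; split => //; [move=> [_ /h]|move=> At; apply: h].
  exact: measurableD measurable_Iunit mA.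
move=> F _ _ mF; rewrite preimage_bigcup setI_bigcupr.
exact: bigcupT_measurable.
Qed.

Definition push_mu (B : set T) : R := fine (L (Iunit `&` Phi @^-1` B)).

Lemma push_muE (B : set T) : d_borel d B ->
  L (Iunit `&` Phi @^-1` B) = (push_mu B)%:E.
Proof.
move=> bB; rewrite /push_mu fineK// ge0_fin_numE//.
apply: (@le_lt_trans _ _ (L Iunit)); last by rewrite lebesgue_Iunit ltry.
by apply: le_lebesgue (push_measurable _ bB) measurable_Iunit _ => s [].
Qed.

Lemma push_prob : prob_on (d_borel d) push_mu.
Proof.
split; first by rewrite /push_mu preimage_set0 setI0 measure0.
split; first by move=> A bA; rewrite fine_ge0.
split; first by rewrite /push_mu preimage_setT setIT lebesgue_Iunit.
move=> F bF tF.
have mF n : measurable (Iunit `&` Phi @^-1` F n) by exact: push_measurable.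
have tG : trivIset setT (fun n => Iunit `&` Phi @^-1` F n).
  move=> k l _ _ [t [[_ Fk] [_ Fl]]]; apply: tF => //.
  by exists (Phi t).
have mU : measurable (\bigcup_n (Iunit `&` Phi @^-1` F n)).
  exact: bigcupT_measurable.
have cI := @measure_semi_sigma_additive _ _ _ L _ mF tG mU.
have -> : (fun n : nat => \sum_(k < n) push_mu (F k)) =
    fine \o (fun n : nat => (\sum_(0 <= i < n) L (Iunit `&` Phi @^-1` F i))%E).
  apply/funext => n /=; rewrite big_mkord.
  by rewrite (eq_bigr (fun i : 'I_n => (push_mu (F i))%:E)) ?sumEFin// => i _; exact: push_muE.
apply: fine_cvg; rewrite -push_muE; last exact: d_borel_bigcup.
by rewrite preimage_bigcup setI_bigcupr; exact: cI.
Qed.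

Definition push_space : mmspace R :=
  MMSpace R T d push_mu d_metric d_compl d_sep push_prob.

Lemma push_parameter : is_parameter push_space Phi.
Proof. by split; [exact: push_measurable|exact: push_muE]. Qed.

End Pushforward.

(* The second factor is [nat] and not an arbitrary finite type because the
   universe of [finType] is larger than the one allowed in [mmspace]. *)
Section DiscreteProduct.
Context {R : realType} (X : mmspace R) (phi : R -> X) (pphi : is_parameter X phi).
Context (r : R -> nat).
Context (r_meas : forall a, measurable (Iunit `&` r @^-1` [set a])).
Context (e : R) (e0 : 0 < e).
Local Notation L := (@lebesgue_measure R).

Definition jump_d (x y : X * nat) : R :=
  mm_d X x.1 y.1 + (if x.2 == y.2 then 0 else e).

Lemma jump_ge0 (a b : nat) : 0 <= (if a == b then 0 else e).
Proof. by case: ifP => // _; exact: ltW. Qed.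

Lemma jump_d_metric : is_metric jump_d.
Proof.
split; [|split].
- move=> [x a] [y b]; rewrite /jump_d /=; split.
    move=> /eqP; rewrite paddr_eq0 ?mm_d_ge0 ?jump_ge0// => /andP[/eqP xy].
    have [hx _] := mm_metric R X; rewrite (proj1 (hx x y) xy).
    by have [->//|_] := eqVneq a b; rewrite gt_eqF.
  by move=> [-> ->]; rewrite mm_dxx eqxx addr0.
- by move=> [x a] [y b]; rewrite /jump_d /= mm_dC eq_sym.
- move=> [x a] [y b] [z c]; rewrite /jump_d /=.
  rewrite addrACA lerD//; first exact: mm_d_triangle.
  have [->|ab] := eqVneq a b; first by rewrite add0r.
  by have := jump_ge0 b c; case: (a == c) => ?; rewrite ?lerDl// addr_ge0// ltW.
Qed.

(** A change of the second coordinate costs at least [e], so along a Cauchy sequence this coordinate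
    is eventually constant. *)
Lemma jump_d_complete : d_complete jump_d.
Proof.
move=> u cu; have [N hN] := cu e e0.
have stable n : (N <= n)%N -> (u n).2 = (u N).2.
  move=> Nn; have := hN _ _ Nn (leqnn N); rewrite /jump_d; case: eqP => // _ h.
  by exfalso; have := mm_d_ge0 X (u n).1 (u N).1; lra.
have cu1 : d_cauchy (mm_d X) (fun n => (u n).1).
  move=> eps eps0; have [M hM] := cu _ eps0; exists M => m n Mm Mn.
  apply: le_lt_trans (hM _ _ Mm Mn); rewrite /jump_d lerDl; exact: jump_ge0.
have [x hx] := mm_complete R X _ cu1.
exists (x, (u N).2) => eps eps0; have [M hM] := hx _ eps0.
exists (maxn N M) => n; rewrite geq_max => /andP[Nn Mn].
by rewrite /jump_d /= stable// eqxx addr0; exact: hM.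
Qed.

Lemma jump_d_separable : d_separable jump_d.
Proof.
have [D [cD hD]] := mm_separable R X.
exists (D `*` setT); split.
  by apply: countableX => //; exact: countableP.
move=> [x a] eps eps0; have [y [Dy xy]] := hD x _ eps0.
by exists (y, a); split => //; rewrite /jump_d /= eqxx addr0.
Qed.

Definition jump_map (t : R) : X * nat := (phi t, r t).

(** [U] is cut into its countably many slices over [nat], each of which is open in [X]. *)
Lemma jump_map_open U : d_open jump_d U -> measurable (Iunit `&` jump_map @^-1` U).
Proof.
move=> oU.
have -> : Iunit `&` jump_map @^-1` U = \bigcup_a
    ((Iunit `&` r @^-1` [set a]) `&` (Iunit `&` phi @^-1` [set x | U (x, a)])).
  apply/seteqP; split => t; first by move=> [It Ut]; exists (r t).
  by move=> [a _ [[It ra] [_ Ut]]]; split => //; rewrite /= /jump_map ra.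
apply: bigcupT_measurable => a; apply: measurableI => //.
have [mphi _] := pphi; apply: mphi; apply: d_borel_open => x /= Ux.
have [s s0 hs] := oU _ Ux; exists s => // y xy; apply: hs.
by rewrite /jump_d /= eqxx addr0.
Qed.

Definition jump_space : mmspace R :=
  push_space jump_d jump_map jump_d_metric jump_d_complete jump_d_separable jump_map_open.

Lemma box_dist_jump : box_dist X jump_space <= e.
Proof.
apply: inf_le_of => [x []//|]; split; first exact: ltW.
(* The two parameters share their first coordinate, so on all of [Iunit] the distances differ by 0
   or [e]. *)
exists phi, jump_map, Iunit; split => //.
- exact: push_parameter.
- by split => //; exact: measurable_Iunit.
- by rewrite lebesgue_Iunit lee_fin gerBl ltW.
- move=> s t _ _ /=; rewrite /jump_d /= opprD addNKr normrN ger0_norm ?jump_ge0//.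
  by case: ifP => // _; exact: ltW.
Qed.

End DiscreteProduct.

(** * Binary digits on the unit interval *)

Section RandomBits.
Context {R : realType}.
Local Notation L := (@lebesgue_measure R).

(** For [N = 2 ^ n] and [t] in [[0,1)], this is the number written by the first [n] binary digits of
    [t]. *)
Definition digit (N : nat) (t : R) : nat := Num.truncn (t * N%:R).

Definition digit_cell (N k : nat) : set R := Iunit `&` digit N @^-1` [set k].

Lemma digit_cellE N k : (0 < N)%N ->
  digit_cell N k = Iunit `&` `[k%:R / N%:R, k.+1%:R / N%:R[%classic.
Proof.
move=> N0; have N0' : 0 < N%:R :> R by rewrite ltr0n.
apply/seteqP; split => t /= [It].
  move: (It); rewrite /Iunit /= !in_itv /= => /andP[t0 t1] /eqP ht; split => //.
  have tN : 0 <= t * N%:R by rewrite mulr_ge0// ltW.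
  by rewrite ler_pdivrMr// ltr_pdivlMr// -truncn_eq.
move: (It); rewrite /Iunit /= !in_itv /= => /andP[t0 t1] ht; split => //=.
have tN : 0 <= t * N%:R by rewrite mulr_ge0// ltW.
by apply/eqP; rewrite /digit truncn_eq// -ler_pdivrMr// -ltr_pdivlMr.
Qed.

Lemma measurable_digit_cell N k : (0 < N)%N -> measurable (digit_cell N k).
Proof.
move=> N0; rewrite digit_cellE//.
by apply: measurableI; [exact: measurable_Iunit|exact: measurable_itv].
Qed.

Lemma lebesgue_digit_cell N k : (k < N)%N -> L (digit_cell N k) = (N%:R^-1)%:E.
Proof.
move=> kN; have N0 : (0 < N)%N by exact: leq_ltn_trans kN.
have N0' : 0 < N%:R :> R by rewrite ltr0n.
rewrite digit_cellE// setIidr.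
  rewrite lebesgue_measure_itv /= lte_fin ltr_pM2r ?invr_gt0// ltr_nat ltnSn.
  by rewrite -EFinD -mulrBl -natrB// subSnn mul1r.
move=> t; rewrite /= !in_itv /= => /andP[h1 h2]; apply/andP; split.
  by apply: le_trans h1; rewrite divr_ge0// ltW.
by apply: lt_le_trans h2 _; rewrite ler_pdivrMr// mul1r ler_nat.
Qed.

(** Flipping bit [i] is an involution that exchanges the words with [a i != a j] and those with
    [a i = a j]. *)
Lemma half_bits (n : nat) (i j : 'I_n) (c : R) : i != j ->
  (\sum_(a : {ffun 'I_n -> bool} | a i != a j) c) * 2 =
  #|{ffun 'I_n -> bool}|%:R * c.
Proof.
move=> ij; pose flip (a : {ffun 'I_n -> bool}) := [ffun k => (k == i) (+) a k].
have flipK : involutive flip.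
  by move=> a; apply/ffunP => k; rewrite !ffunE addbA addbb.
have h : \sum_(a : {ffun 'I_n -> bool} | a i != a j) c =
         \sum_(a : {ffun 'I_n -> bool} | ~~ (a i != a j)) c.
  rewrite (reindex_inj (inv_inj flipK)); apply: eq_bigl => a.
  rewrite !ffunE eqxx (eq_sym j) (negbTE ij) /=.
  by case: (a i); case: (a j).
rewrite mulr_natr mulr2n {2}h -(bigID (fun a : {ffun 'I_n -> bool} => a i != a j) xpredT) /=.
by rewrite sumr_const mulr_natl.
Qed.

(** Numbers are decoded by the enumeration of all bit words rather than by binary expansion: any
    bijection serves, since the digit cells have equal length. *)
Definition bit (n : nat) (k : nat) (i : 'I_n) : bool :=
  nth [ffun=> false] (enum {ffun 'I_n -> bool}) k i.

Lemma lebesgue_bits (n : nat) (i j : 'I_n) : i != j ->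
  let N := #|{ffun 'I_n -> bool}| in
  exists A : set R, [/\ measurable A, L A = (2^-1)%:E, A `<=` Iunit &
    forall t, A t -> bit n (digit N t) i != bit n (digit N t) j].
Proof.
move=> ij N.
have N0 : (0 < N)%N by apply/card_gt0P; exists [ffun=> false].
have N0' : N%:R != 0 :> R by rewrite pnatr_eq0 -lt0n.
pose P (k : 'I_N) := bit n k i != bit n k j.
have mc (k : 'I_N) : measurable (digit_cell N k) by exact: measurable_digit_cell.
exists (\big[setU/set0]_(k < N | P k) digit_cell N k); split.
- exact: bigsetU_measurable.
- rewrite (@measure_bigsetU_ord _ _ _ L N P (fun k => digit_cell N k))//; last first.
    by move=> k l _ _ [t [[_ /= tk] [_ /= tl]]]; apply: val_inj; rewrite /= -tk -tl.
  rewrite (eq_bigr (fun=> (N%:R^-1)%:E)); last by move=> k _; exact: lebesgue_digit_cell.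
  rewrite sumEFin; congr EFin.
  have -> : \sum_(k < N | P k) N%:R^-1 =
      \sum_(a : {ffun 'I_n -> bool} | a i != a j) N%:R^-1 :> R.
    rewrite [RHS](reindex _ (onW_bij _ (@enum_val_bij {ffun 'I_n -> bool}))) /=.
    apply: eq_bigl => k.
    by rewrite (enum_val_nth [ffun=> false]).
  have := half_bits n i j N%:R^-1 ij; rewrite mulfV//.
  by move: (\sum_(_ | _) _) => s; lra.
- by rewrite -bigcup_seq_cond => t [k _ []].
- by move=> t; rewrite -bigcup_seq_cond => -[k /= /andP[_ Pk] [_ /= ->]].
Qed.

End RandomBits.

(** * Absence of compact neighborhoods *)

Section Main.
Context {R : realType}.
Local Notation L := (@lebesgue_measure R).

(** The threshold [k0] is chosen before [n]: near [X] there are arbitrarily large families with one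
    fixed separation. *)
Lemma separated_nearby (X : mmspace R) (r : R) : 0 < r ->
  exists2 k0, 0 < k0 & forall n, exists2 Y : mmspace R, box_dist X Y < r &
    forall kappa, kappa < k0 -> ~ few_separated Y kappa n.
Proof.
(* The bound [r / 2] keeps [Y] close to [X]; the bound [2^-1] makes the measure 1/2, on which two
   bits differ, exceed every [kappa < e]. *)
move=> r0; pose e := Num.min (r / 2) 2^-1.
have e0 : 0 < e by rewrite lt_min; apply/andP; split; lra.
have er : e < r by rewrite gt_min; apply/orP; left; lra.
have e1 : e <= 2^-1 by rewrite ge_min lexx orbT.
have [phi pphi] := parameter_ex X.
exists e => // n; pose N := #|{ffun 'I_n -> bool}|.
have N0 : (0 < N)%N by apply/card_gt0P; exists [ffun=> false].
have mdig k : measurable (Iunit `&` @digit R N @^-1` [set k]).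
  exact: measurable_digit_cell.
pose Y := jump_space X phi pphi (@digit R N) mdig e e0.
exists Y; first exact: le_lt_trans (box_dist_jump _ _ _ _ _ _ _) er.
move=> kappa ke fs.
(* Bit [i] scaled by [e]: it is 1-Lipschitz because changing the second coordinate costs [e]. *)
pose h (i : 'I_n) (x : Y) : R := if bit n x.2 i then e else 0.
have lh i : lip1 Y (h i).
  move=> [x a] [y b]; rewrite /h /= /jump_d /=.
  have [->|ab] := eqVneq a b; first by rewrite subrr normr0 addr0 mm_d_ge0.
  have := mm_d_ge0 X x y.
  by do 2 case: ifP => _; rewrite ?subrr ?subr0 ?sub0r ?normrN ?normr0 ?gtr0_norm//; lra.
have [|i [j [ij hij]]] := fs h.
  by move=> i; split => // x; rewrite /h; case: ifP => _; apply/andP; split; lra.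
have [A [mA LA AI Abit]] := @lebesgue_bits R n i j ij.
pose Phi := jump_map X phi (@digit R N).
have pPhi : is_parameter Y Phi by exact: (push_parameter (jump_d X e)).
suff : 2^-1 <= kappa by lra.
apply: le_trans hij; rewrite -lee_fin -(mm_mu_deviation _ _ _ _ _ (lh i) (lh j) pPhi) -LA.
apply: le_lebesgue => //.
  by apply: measurable_deviation; exact: lip1_measurable.
move=> t At; split; first exact: AI.
have := Abit _ At; rewrite /h /Phi /jump_map /=.
by case: bit; case: bit => //= _; rewrite ?subr0 ?sub0r ?normrN gtr0_norm.
Qed.

(** The strict inequality [kappa < k0] leaves room for the loss [2 * r] in [few_separated_conc],
    which makes the set open. *)
Definition tame_set (k0 : R) (m : nat) : set (mmspace R) :=
  [set X | exists2 kappa, kappa < k0 & few_separated X kappa m].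

Lemma tame_set_open k0 m : d_open conc_dist (tame_set k0 m).
Proof.
(* With this radius the new threshold is the midpoint of [kappa] and [k0]. *)
move=> X [kappa kk fs]; exists ((k0 - kappa) / 4); first by lra.
move=> Y /few_separated_conc /(_ fs) fY.
by exists (kappa + 2 * ((k0 - kappa) / 4)) => //; lra.
Qed.

Lemma tame_set_nondecreasing k0 m n : (m <= n)%N -> tame_set k0 m `<=` tame_set k0 n.
Proof. by move=> mn X [kappa kk /(few_separatedW _ _ _ _ mn)]; exists kappa. Qed.

Lemma tame_set_cover k0 (X : mmspace R) : 0 < k0 -> exists m, tame_set k0 m X.
Proof.
move=> k00; have [|m hm] := few_separated_ex X (k0 / 2); first by lra.
by exists m, (k0 / 2) => //; lra.
Qed.

Lemma d_open_box_of_conc (U : set (mmspace R)) : d_open conc_dist U -> d_open box_dist U.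
Proof.
move=> oU X UX; have [r r0 h] := oU X UX.
by exists r => // Y /conc_dist_lt_box; exact: h.
Qed.

End Main.

Lemma compact_nondecreasing_cover (T : topologicalType) (N : set T)
    (U : nat -> set T) : compact N -> (forall m, open (U m)) ->
  (forall m n, (m <= n)%N -> U m `<=` U n) -> (forall x, exists m, U m x) ->
  exists m, N `<=` U m.
Proof.
move=> cN oU ndU cU; apply: contrapT => nsub.
(* If no [U m] contains [N], these differences generate a proper filter; a cluster point in [N]
   would lie in some [U m], which is disjoint from a member of the filter. *)
pose F : set_system T := [set A | exists m, N `\` U m `<=` A].
have FF : ProperFilter F.
  split; [|split].
  - move=> [m hm]; apply: nsub; exists m => x Nx; apply: contrapT => nUx.
    exact: (hm x).
  - by exists 0%N.
  - move=> A B [m hm] [n hn]; exists (maxn m n) => x [Nx nU]; split.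
      by apply: hm; split => // /(ndU _ _ (leq_maxl m n)).
    by apply: hn; split => // /(ndU _ _ (leq_maxr m n)).
  - by move=> A B AB [m hm]; exists m => x /hm /AB.
have [|x [Nx clx]] := cN F FF; first by exists 0%N => x [].
have [m Umx] := cU x.
have FU : F (N `\` U m) by exists m.
have xU : nbhs x (U m) by apply: open_nbhs_nbhs.
by have [y [[_ nUy] Uy]] := clx _ _ FU xU.
Qed.

Theorem theorem1p1 (R : realType) :
  (forall X : box_space R,
     ~ exists N : set (box_space R), nbhs X N /\ compact N) /\
  (forall X : conc_space R,
     ~ exists N : set (conc_space R), nbhs X N /\ compact N).
Proof.
split=> X [N [+ cN]]; rewrite nbhsE => -[V [oV VX] VN].
- have [r r0 hr] : exists2 r : R, 0 < r & forall Y, box_dist X Y < r -> V Y.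
    exact: oV.
  have [k0 k00 hk] := separated_nearby X r r0.
  have [m hm] := compact_nondecreasing_cover (box_space R) N (tame_set k0) cN
    (fun m => d_open_box_of_conc _ (tame_set_open k0 m))
    (@tame_set_nondecreasing R k0) (fun Y => tame_set_cover k0 Y k00).
  (* Compactness provides one [m] for all of [N]; the nearby space built for this [m] lies in [N]
     but not in [tame_set k0 m]. *)
  have [Y XY hY] := hk m.
  by have [kappa /hY] := hm Y (VN Y (hr Y XY)).
- have [r r0 hr] : exists2 r : R, 0 < r & forall Y, conc_dist X Y < r -> V Y.
    exact: oV.
  have [k0 k00 hk] := separated_nearby X r r0.
  have [m hm] := compact_nondecreasing_cover (conc_space R) N (tame_set k0) cN
    (tame_set_open k0)
    (@tame_set_nondecreasing R k0) (fun Y => tame_set_cover k0 Y k00).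
  have [Y XY hY] := hk m.
  (* [Y] is close to [X] in the box distance, hence also in the observable distance. *)
  by have [kappa /hY] := hm Y (VN Y (hr Y (conc_dist_lt_box _ _ _ XY))).
Qed.
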